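(* In the setting of the context (Gaussian noise of scale $\epsilon$), let $u\in\mathcal B_R$ and suppose that there is a set $U(u)\subset\mathcal B_R$ (the leaf set of $u$) such that $\{\|v-u\|_2: v\in U(u)\}=[0,d^{(2)}_{\max}(u)]$ for some $d^{(2)}_{\max}(u)>0$, and a finite constant $C_U^{(2)}(u)$ such that for every $v\in U(u)$, $$\sup_{k\in\mathbb N}\ \sum_{i=0}^k\|\Psi_{t_i}(v)-\Psi_{t_i}(u)\|_2^2\le C_U^{(2)}(u)\,\|v-u\|_2^2 .$$ Suppose that the density of the prior $q$ is continuous at the point $u$, and $q(v)>0$ for every $v\in U(u)$. Then for $\epsilon>0$ sufficiently small (with threshold independent of $k$), for every $k\in\mathbb N$, $$\mathbb E\left[\left.\mathrm{diam}_2\left\{v\in\mathbb R^d:\frac{\mu^{\mathrm{sm}}(v|Y_0,\ldots,Y_k)}{\mu^{\mathrm{sm}}(u|Y_0,\ldots,Y_k)}\ge\frac1e\right\}\right|u\right]\ge\frac{1}{2\|H\|_2\sqrt{C_U^{(2)}(u)}}\cdot\epsilon,$$ where $\mathrm{diam}_2$ denotes the diameter with respect to the Euclidean distance.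
   Context: Dynamics: $\frac{du}{dt}=-Au-B(u,u)+f$ on $\mathbb R^d$, with $A$ a linear operator, $B:\mathbb R^d\times\mathbb R^d\to\mathbb R^d$ bilinear, $f\in\mathbb R^d$. For $v\in\mathbb R^d$, $v(t)=\Psi_t(v)$ is the solution with $v(0)=v$. Trapping ball assumption: there are $R,\delta>0$ with $\langle -Av-B(v,v)+f,v\rangle\le0$ whenever $\|v\|\in[R,R+\delta]$. $\mathcal B_R=\{v:\|v\|\le R\}$; for $v\in\mathcal B_R$ the solution exists for all $t\ge0$ and stays in $\mathcal B_R$. Observations: $t_i=ih$ with fixed $h>0$, $Y_i=Hu(t_i)+Z_i$, $H\in\mathbb R^{d_o\times d}$ nonzero, $Z_i$ i.i.d. such that $Z_i/\epsilon$ has the $d_o$-dimensional standard Gaussian distribution; $\eta$ is the density of $Z_i$. The prior $q$ is a probability density on $\mathbb R^d$ vanishing outside $\mathcal B_R$. The smoothing density is $\mu^{\mathrm{sm}}(v|Y_0,\ldots,Y_k)\propto q(v)\prod_{i=0}^k\eta(Y_i-H\Psi_{t_i}(v))$ for $v\in\mathcal B_R$, and $0$ otherwise. $\mathbb E[\cdot|u]$ is expectation over the noise with true initial point $u$. $\|H\|_2$ is the operator norm induced by the Euclidean norm. *)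

(* Defs.v *)
From HB Require Import structures.
From mathcomp Require Import all_boot all_order all_algebra.
From mathcomp Require Import all_classical all_reals all_analysis.
Import numFieldNormedType.Exports.

Set Implicit Arguments.
Unset Strict Implicit.
Unset Printing Implicit Defensive.

Import Order.TTheory GRing.Theory Num.Theory.

Local Open Scope classical_set_scope.
Local Open Scope ring_scope.

(* R^n is 'cV[R]_n. The library norm on matrices is the sup norm, hence the
   separate Euclidean notions below; the topology is the same. *)
Section euclidean.
Context {R : realType}.

Definition dot {n} (x y : 'cV[R]_n) : R := \sum_(i < n) x i 0 * y i 0.

Definition enorm {n} (x : 'cV[R]_n) : R := Num.sqrt (dot x x).

Definition eball n (r : R) : set 'cV[R]_n := [set v | enorm v <= r].

Definition opnorm {m n} (H : 'M[R]_(m, n)) : R :=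
  sup [set enorm (H *m x) | x in @eball n 1].

(* The diameter of the empty set is 0. *)
Definition ediam {n} (S : set 'cV[R]_n) : \bar R :=
  maxe 0%E (ereal_sup [set (enorm (x - y))%:E | x in S & y in S]).

End euclidean.

Definition cV_display : measure_display. Proof. exact: default_measure_display. Qed.

(* The sigma-algebra generated by the coordinates, i.e. the Borel sets of
   R^n. *)
Section measurable_cV.
Context {R : realType} (n : nat).

Let coord (i : 'I_n) (v : 'cV[R]_n) : measurableTypeR R := v i 0.

Let cV_set0 : g_sigma_preimage coord set0.
Proof. exact: sigma_algebra0. Qed.

Let cV_setC A : g_sigma_preimage coord A -> g_sigma_preimage coord (~` A).
Proof. exact: sigma_algebraC. Qed.

Let cV_bigcup (F : _^nat) : (forall i, g_sigma_preimage coord (F i)) ->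
  g_sigma_preimage coord (\bigcup_i (F i)).
Proof. exact: sigma_algebra_bigcup. Qed.

HB.instance Definition _ := @isMeasurable.Build cV_display
  'cV[R]_n (g_sigma_preimage coord) cV_set0 cV_setC cV_bigcup.

End measurable_cV.

Lemma measurable_fun_cVP {R : realType} d (T : measurableType d) n
    (f : T -> 'cV[R]_n) :
  measurable_fun [set: T] f <->
  forall i, measurable_fun [set: T] ((fun x => f x i 0) : T -> measurableTypeR R).
Proof.
pose coord (i : 'I_n) (v : 'cV[R]_n) : measurableTypeR R := v i 0.
split=> [mf i|mf].
  move=> _ A mA; apply: (mf measurableT (coord i @^-1` A)).
  apply: sub_sigma_algebra.
  rewrite -bigcup_seq/=; exists i => /=; first by rewrite mem_index_enum.
  by exists A => //; rewrite setTI.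
suff : g_sigma_preimage (fun i => coord i \o f) `<=` measurable.
  rewrite g_sigma_preimage_comp => prefS _ A mA; apply: prefS; exists A => //.
apply: smallest_sub; first exact: sigma_algebra_measurable.
rewrite -bigcup_seq => A [i _] [E mE <-].
by apply: (mf i).
Qed.

Section lebesgue_cV.
Context {R : realType}.

Definition cV_cons n (p : measurableTypeR R * 'cV[R]_n) : 'cV[R]_n.+1 :=
  col_mx (p.1%:M : 'M[R]_1) p.2.

Lemma measurable_cV_cons n : measurable_fun [set: _] (@cV_cons n).
Proof.
apply/measurable_fun_cVP => i; case: (unliftP ord0 i) => [j|] ->.
  rewrite (_ : (fun x => _) = fun x : measurableTypeR R * 'cV[R]_n => x.2 j 0).
    have /measurable_fun_cVP : measurable_fun setT (@snd (measurableTypeR R) 'cV[R]_n).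
      exact: measurable_snd.
    exact.
  apply/funext => x; rewrite /cV_cons.
  rewrite (_ : lift ord0 j = rshift 1 j); last exact/val_inj.
  by rewrite [LHS](@col_mxEd _ 1).
rewrite (_ : (fun x => _) = fst); first exact: measurable_fst.
apply/funext => x; rewrite /cV_cons.
rewrite (_ : ord0 = lshift n (0 : 'I_1)); last exact/val_inj.
by rewrite [LHS](@col_mxEu _ 1) mxE.
Qed.

Definition lebesgue_cVS n (mu : {measure set 'cV[R]_n -> \bar R}) :
    set 'cV[R]_n.+1 -> \bar R :=
  pushforward (lebesgue_measure \x^ mu)%E (@cV_cons n).

HB.instance Definition _ n (mu : {measure set 'cV[R]_n -> \bar R}) :=
  Measure.copy (lebesgue_cVS mu)
    (measure_function_pushforward__canonical__measure_function_Measure _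
       (measurable_cV_cons (n := n))).

(* Lebesgue measure on R^n.+1 is the image of the product of the Lebesgue
   measures on R and R^n under (x, v) |-> col_mx x v. *)
Fixpoint lebesgue_cV n : {measure set 'cV[R]_n -> \bar R} :=
  if n is n'.+1 then lebesgue_cVS (lebesgue_cV n') else \d_(0 : 'cV[R]_0).

End lebesgue_cV.

(* x is a solution of dx/dt = F(x) on [0, +oo[ started at v. *)
Definition is_solution {R : realType} d (F : 'cV[R]_d -> 'cV[R]_d)
    (x : R -> 'cV[R]_d) (v : 'cV[R]_d) :=
  [/\ x 0 = v, {within `[0, +oo[, continuous x} &
      forall t : R, 0 < t -> is_derive t 1 x (F (x t))].

Definition is_density {R : realType} d (q : 'cV[R]_d -> R) :=
  [/\ measurable_fun [set: 'cV[R]_d] q, forall v, 0 <= q v &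
      (\int[lebesgue_cV d]_v (q v)%:E = 1)%E].

(* Density of the centred Gaussian on R^n with covariance s^2 I;
   normal_peak s is the reciprocal of sqrt (2 pi s^2). *)
Definition gauss_pdf {R : realType} n (s : R) (z : 'cV[R]_n) : R :=
  normal_peak s ^+ n * expR (- (enorm z ^+ 2 / (2 * s ^+ 2))).

(* Mutual independence of a sequence of random variables; finite subfamilies
   are covered by taking E i to be the full set outside the subfamily. *)
Definition mutually_independent {R : realType} d d' (T : measurableType d)
    (T' : measurableType d') (P : probability T R) (X : nat -> T -> T') :=
  forall (n : nat) (E : nat -> set T'), (forall i, measurable (E i)) ->
    (P (\bigcap_(i < n) (X i @^-1` E i)) = \prod_(i < n) P (X i @^-1` E i))%E.

Definition is_std_gaussian {R : realType} d (T : measurableType d)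
    (P : probability T R) n (X : T -> 'cV[R]_n) :=
  measurable_fun [set: T] X /\
  forall E : set 'cV[R]_n, measurable E ->
    (P (X @^-1` E) = \int[lebesgue_cV n]_(z in E) (gauss_pdf 1 z)%:E)%E.

Definition is_gaussian_noise {R : realType} d (T : measurableType d)
    (P : probability T R) n (eps : R) (Z : nat -> T -> 'cV[R]_n) :=
  [/\ forall i, measurable_fun [set: T] (Z i),
      mutually_independent P Z &
      forall i, is_std_gaussian P (fun w => eps^-1 *: Z i w)].

Section smoothing.
Context {R : realType} (d m : nat).
Variables (rho h eps : R) (H : 'M[R]_(m, d)) (Psi : R -> 'cV[R]_d -> 'cV[R]_d).
Variables (q : 'cV[R]_d -> R) (k : nat) (Y : nat -> 'cV[R]_m).

Definition smoothing_weight (v : 'cV[R]_d) : R :=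
  if enorm v <= rho then
    q v * \prod_(i < k.+1) gauss_pdf eps (Y i - H *m Psi (i%:R * h) v)
  else 0.

(* The denominator normalises the weight to a probability density. *)
Definition smoothing_density (v : 'cV[R]_d) : R :=
  smoothing_weight v / fine (\int[lebesgue_cV d]_x (smoothing_weight x)%:E)%E.

End smoothing.

(* Main.v *)
Require Import Defs.
From mathcomp Require Import all_boot all_order all_algebra.
From mathcomp Require Import all_classical all_reals all_analysis.
From mathcomp Require Import measurable_realfun ring lra.
Import numFieldNormedType.Exports.
Import Order.TTheory GRing.Theory Num.Theory.
Local Open Scope classical_set_scope.
Local Open Scope ring_scope.

(** The posterior ratio at a leaf point [v] against the true point [u] involves
    the data only through a linear statistic of the noise.  With
    [x_i = H (Psi_{t_i} v - Psi_{t_i} u)], completing the square in the Gaussian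
    densities gives
      mu v / mu u
        = q v / q u * exp ((sum_i <Z_i, x_i> - 1/2 sum_i |x_i|^2) / eps^2).
    The leaf bound gives [sum_i |x_i|^2 <= opnorm H ^ 2 * CU * |v - u|^2], which
    is at most [eps ^ 2] for [v] at distance [r = eps / (opnorm H * sqrt CU)]
    from [u].  On the half-space where [sum_i <Z_i, x_i>] is nonnegative, the
    likelihood ratio is then at least [exp (- 1/2)]; when [eps], and hence [r],
    is small, continuity of the prior gives [q v / q u >= exp (- 1/2)] as well.
    There the level set contains both [u] and [v], so its diameter is at least
    [r].  The length of the observation window never enters, hence a threshold
    that does not depend on [k].

    The half-space has probability at least [1/2] ([noise_halfspace]) because
    the noise sequence has the same joint law as its opposite, so that a linear
    statistic and its opposite are equally likely to be nonnegative.  The law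
    of the statistic itself is never computed.  The expected diameter is
    therefore at least [r / 2], which is the claim.

    The ratio of densities is the ratio of unnormalised weights only if the
    normalising integral is neither [0] nor infinite, and this is where the
    dynamics matter: by the trapping condition ([trapped]) trajectories started
    in the ball stay there, so for each realisation of the data the likelihood
    is bounded above and away from [0] over the ball, and the weight lies
    between two positive multiples of the prior ([smoothing_normaliser_gt0]).
    Comparing with the prior avoids having to know that the weight is measurable,
    which would require regularity of [Psi] in its initial point. *)

(** * The Euclidean norm and the operator norm *)

Section Euclid.
Context {R : realType}.

Lemma dot_ge0 n (x : 'cV[R]_n) : 0 <= dot x x.
Proof. by apply: sumr_ge0 => i _; rewrite -expr2 sqr_ge0. Qed.

Lemma dotC n (x y : 'cV[R]_n) : dot x y = dot y x.
Proof. by apply: eq_bigr => i _; rewrite mulrC. Qed.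

Lemma dotDl n (x y z : 'cV[R]_n) : dot (x + y) z = dot x z + dot y z.
Proof. by rewrite -big_split; apply: eq_bigr => i _; rewrite !mxE mulrDl. Qed.

Lemma dotZl n a (x z : 'cV[R]_n) : dot (a *: x) z = a * dot x z.
Proof. by rewrite /dot mulr_sumr; apply: eq_bigr => i _; rewrite !mxE mulrA. Qed.

Lemma dotNl n (x z : 'cV[R]_n) : dot (- x) z = - dot x z.
Proof. by rewrite -scaleN1r dotZl mulN1r. Qed.

Lemma dot_subsq n (x y : 'cV[R]_n) :
  dot (x - y) (x - y) = dot x x - 2 * dot x y + dot y y.
Proof.
rewrite dotDl dotNl (dotC _ x) (dotC _ y) !dotDl !dotNl (dotC _ y x).
ring.
Qed.

Lemma enorm_ge0 n (x : 'cV[R]_n) : 0 <= enorm x.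
Proof. exact: sqrtr_ge0. Qed.

Lemma enorm_sq n (x : 'cV[R]_n) : enorm x ^+ 2 = dot x x.
Proof. by rewrite sqr_sqrtr// dot_ge0. Qed.

Lemma dot_eq0 n (x : 'cV[R]_n) : dot x x = 0 -> x = 0.
Proof.
move=> /eqP; rewrite psumr_eq0; last by move=> i _; rewrite -expr2 sqr_ge0.
move=> /allP x0; apply/matrixP => i j; rewrite ord1 mxE.
by have := x0 i (mem_index_enum i); rewrite -expr2 sqrf_eq0 => /eqP.
Qed.

Lemma enorm_eq0 n (x : 'cV[R]_n) : enorm x = 0 -> x = 0.
Proof. by move=> x0; apply: dot_eq0; rewrite -enorm_sq x0 expr0n. Qed.

Lemma enormZ n a (x : 'cV[R]_n) : enorm (a *: x) = `|a| * enorm x.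
Proof.
by rewrite /enorm dotZl dotC dotZl mulrA -expr2 sqrtrM ?sqr_ge0// sqrtr_sqr.
Qed.

Lemma coord_le_enorm n (x : 'cV[R]_n) i : `|x i 0| <= enorm x.
Proof.
rewrite -sqrtr_sqr ler_wsqrtr// /dot (bigD1 i)//= -expr2 lerDl.
by apply: sumr_ge0 => j _; rewrite -expr2 sqr_ge0.
Qed.

(** Nonnegativity of the square norm of [dot y y *: x - dot x y *: y]. *)
Lemma dot_CauchySchwarz n (x y : 'cV[R]_n) :
  dot x y ^+ 2 <= dot x x * dot y y.
Proof.
have [y0|y0] := eqVneq (dot y y) 0.
  rewrite (dot_eq0 _ _ y0) dotC -{1}(scale0r (0 : 'cV[R]_n)) dotZl mul0r expr0n.
  by rewrite mulr_ge0// dot_ge0.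
have yp : 0 < dot y y by rewrite lt_def y0 dot_ge0.
have := dot_ge0 _ (dot y y *: x - dot x y *: y).
rewrite dot_subsq !dotZl !(dotC _ _ (_ *: _)) !dotZl (dotC _ y x).
rewrite (_ : _ + _ = dot y y * (dot x x * dot y y - dot x y ^+ 2)); last by ring.
by rewrite pmulr_rge0// subr_ge0.
Qed.

(** The Frobenius norm bounds the action of [H], which makes the supremum in
    [opnorm] a genuine one. *)
Lemma enorm_mulmx_frobenius m n (H : 'M[R]_(m, n)) (x : 'cV[R]_n) :
  enorm (H *m x) <= Num.sqrt (\sum_i dot (row i H)^T (row i H)^T) * enorm x.
Proof.
rewrite -sqrtrM; last by apply: sumr_ge0 => i _; exact: dot_ge0.
rewrite ler_wsqrtr// mulr_suml; apply: ler_sum => i _.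
rewrite -expr2; apply: le_trans (dot_CauchySchwarz _ _ _).
rewrite (_ : (H *m x) i 0 = dot (row i H)^T x)// mxE.
by apply: eq_bigr => j _; rewrite !mxE.
Qed.

Lemma has_ubound_opnorm m n (H : 'M[R]_(m, n)) :
  has_ubound [set enorm (H *m x) | x in @eball R n 1].
Proof.
exists (Num.sqrt (\sum_i dot (row i H)^T (row i H)^T)) => _ [x x1 <-].
apply: le_trans (enorm_mulmx_frobenius _ _ _ _) _.
by rewrite ler_piMr// sqrtr_ge0.
Qed.

Lemma enorm_mulmx m n (H : 'M[R]_(m, n)) (x : 'cV[R]_n) :
  enorm (H *m x) <= opnorm H * enorm x.
Proof.
have [x0|x0] := eqVneq (enorm x) 0.
  by apply: le_trans (enorm_mulmx_frobenius _ _ _ _) _; rewrite x0 !mulr0.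
have xp : 0 < enorm x by rewrite lt_def x0 enorm_ge0.
rewrite -ler_pdivrMr// mulrC -[X in X * _]ger0_norm ?invr_ge0 ?enorm_ge0//.
rewrite -enormZ scalemxAr; apply: ub_le_sup; first exact: has_ubound_opnorm.
exists ((enorm x)^-1 *: x) => //.
by rewrite /eball/= enormZ ger0_norm ?invr_ge0 ?enorm_ge0// mulVf.
Qed.

Lemma opnorm_ge0 m n (H : 'M[R]_(m, n)) : 0 <= opnorm H.
Proof.
apply: le_trans (enorm_ge0 _ (H *m 0)) _.
apply: ub_le_sup; first exact: has_ubound_opnorm.
exists 0 => //; rewrite /eball/= -(scale0r (0 : 'cV[R]_n)) enormZ normr0 mul0r.
exact: ler01.
Qed.

Lemma opnorm_gt0 m n (H : 'M[R]_(m, n)) : H != 0 -> 0 < opnorm H.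
Proof.
apply: contra_neqT; rewrite -leNgt => H0.
apply/matrixP => i j; rewrite mxE.
have : H *m delta_mx j (0 : 'I_1) = 0.
  apply: enorm_eq0; apply/eqP; rewrite eq_le enorm_ge0 andbT.
  apply: le_trans (enorm_mulmx _ _ _ _) _.
  by rewrite mulr_le0_ge0// enorm_ge0.
by rewrite -colE => /matrixP/(_ i 0); rewrite !mxE.
Qed.

End Euclid.

(** * Reflection symmetry of the noise *)

Section ReflectionSymmetry.
Context {R : realType}.

Lemma measurable_coord n (i : 'I_n) :
  measurable_fun [set: 'cV[R]_n] (fun x : 'cV[R]_n => x i 0).
Proof.
have /measurable_fun_cVP : measurable_fun setT (@id 'cV[R]_n) by exact: measurable_id.
exact.
Qed.

Lemma measurable_oppcV n :
  measurable_fun [set: 'cV[R]_n] (-%R : 'cV[R]_n -> 'cV[R]_n).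
Proof.
apply/measurable_fun_cVP => i; under eq_fun do rewrite mxE.
by apply: measurableT_comp => //; exact: measurable_coord.
Qed.

(** By induction on the dimension: the sections of a reflected set are the
    reflected sections at the opposite points, so the symmetry of Lebesgue
    measure on the line handles the inner integral and the induction hypothesis
    the outer one. *)
Lemma lebesgue_cVN n (E : set 'cV[R]_n) : measurable E ->
  lebesgue_cV n (-%R @^-1` E) = lebesgue_cV n E.
Proof.
elim: n E => [|n IH] E mE.
  congr (\d_(0 : 'cV[R]_0) _); apply/seteqP; split => x /=;
  by rewrite [- x]flatmx0 [x]flatmx0.
have mC : measurable (@cV_cons R n @^-1` E).
  by rewrite -[X in measurable X]setTI; exact: measurable_cV_cons.
rewrite /= /lebesgue_cVS /pushforward /product_measure2.
transitivity (\int[lebesgue_cV n]_v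
   (lebesgue_measure \o ysection (@cV_cons R n @^-1` E)) (- v)%R)%E.
  apply: eq_integral => v _ /=.
  rewrite -[RHS](lebesgue_measureN (measurable_ysection (- v) mC)).
  rewrite /pushforward; congr (lebesgue_measure _).
  apply/funext => x; rewrite /ysection/= !inE/=.
  congr E; rewrite /cV_cons/=.
  apply: (etrans (opp_col_mx (x%:M : 'M[R]_(1, 1)) v)); congr col_mx.
  by apply/matrixP => i j; rewrite !mxE !ord1.
rewrite -(ge0_integral_pushforward (measurable_oppcV n) (lebesgue_cV n) measurableT
  (measurable_fun_ysection lebesgue_measure mC)) => [|y _]; last exact: measure_ge0.
apply: eq_measure_integral => [|mN A mA _]; first exact: measurable_oppcV.
exact: IH.
Qed.

Lemma measurable_dot {d} {T : measurableType d} n (X Y : T -> 'cV[R]_n) :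
  measurable_fun [set: T] X -> measurable_fun [set: T] Y ->
  measurable_fun [set: T] (fun w => dot (X w) (Y w)).
Proof.
move=> /measurable_fun_cVP mX /measurable_fun_cVP mY.
apply: measurable_sum => i; apply: measurable_funM; [exact: mX|exact: mY].
Qed.

Lemma measurable_gauss_pdf n (s : R) :
  measurable_fun [set: 'cV[R]_n] (gauss_pdf s).
Proof.
apply: measurable_funM => //.
apply: measurableT_comp => //; apply: measurableT_comp => //.
apply: measurable_funM => //.
under eq_fun do rewrite sqr_sqrtr ?dot_ge0//.
by apply: measurable_dot; exact: measurable_id.
Qed.

Lemma gauss_pdfN n (s : R) (z : 'cV[R]_n) : gauss_pdf s (- z) = gauss_pdf s z.
Proof.
by rewrite /gauss_pdf -(scaleN1r z) enormZ normrN normr1 mul1r.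
Qed.

Lemma gauss_pdf_gt0 n (s : R) (z : 'cV[R]_n) : s != 0 -> 0 < gauss_pdf s z.
Proof.
by move=> s0; rewrite mulr_gt0 ?expR_gt0// exprn_gt0// normal_peak_gt0.
Qed.

Lemma std_gaussianN {d} {T : measurableType d} (P : probability T R) n
    (X : T -> 'cV[R]_n) (E : set 'cV[R]_n) :
  is_std_gaussian P X -> measurable E ->
  P (X @^-1` (-%R @^-1` E)) = P (X @^-1` E).
Proof.
move=> [mX PX] mE.
have mNE : measurable (-%R @^-1` E : set 'cV[R]_n).
  by rewrite -[X in measurable X]setTI; exact: measurable_oppcV.
have mg : measurable_fun E (EFin \o @gauss_pdf R n 1).
  by apply: measurable_funTS; apply/measurable_EFinP; exact: measurable_gauss_pdf.
rewrite !PX//.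
under eq_integral do rewrite -gauss_pdfN.
rewrite -(ge0_integral_pushforward (measurable_oppcV n) (lebesgue_cV n) mE mg).
  apply: eq_measure_integral => [|mN A mA _]; first exact: measurable_oppcV.
  exact: lebesgue_cVN.
by move=> y _ /=; rewrite lee_fin ltW// gauss_pdf_gt0// oner_neq0.
Qed.

Section joint.
Context {d d' : measure_display} {T : measurableType d} {T' : measurableType d'}.
Context (P : probability T R) (N : nat).

(** Sequences are only looked at through their first [N] entries: [cylinder]
    generates the product sigma-algebra of these entries, and independence
    prescribes its members' probabilities. *)
Definition cylinder : set (set (nat -> T')) :=
  [set A | exists2 E : nat -> set T', (forall i, measurable (E i)) &
     A = \bigcap_(i < N) ((fun z : nat -> T' => z i) @^-1` E i)].

Definition joint (X : nat -> T -> T') (w : T) : g_sigma_algebraType cylinder :=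
  fun i => X i w.

Lemma measurable_joint (X : nat -> T -> T') :
  (forall i, measurable_fun [set: T] (X i)) ->
  measurable_fun [set: T] (joint X).
Proof.
move=> mX.
apply: (measurability (cylinder : set (set (g_sigma_algebraType cylinder)))) => //.
move=> _ [_ [E mE ->] <-].
rewrite setTI preimage_bigcap; apply: bigcap_measurableType => // i _.
by rewrite -[X in measurable X]setTI; exact: mX.
Qed.

(** Cylinders are stable under intersection, so measures that agree on them
    agree on the sigma-algebra that they generate. *)
Lemma joint_law_eq (X Y : nat -> T -> T') :
  (forall i, measurable_fun [set: T] (X i)) ->
  (forall i, measurable_fun [set: T] (Y i)) ->
  mutually_independent P X -> mutually_independent P Y ->
  (forall i E, measurable E -> P (X i @^-1` E) = P (Y i @^-1` E)) ->
  forall A : set (g_sigma_algebraType cylinder), measurable A ->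
    P (joint X @^-1` A) = P (joint Y @^-1` A).
Proof.
move=> mX mY indX indY XY A mA.
have mX' := measurable_joint _ mX.
have mY' := measurable_joint _ mY.
have cylT : cylinder setT.
  by exists (fun=> setT) => //; rewrite bigcapT.
apply: (measure_unique (cylinder : set (set (g_sigma_algebraType cylinder)))
  (fun=> setT) _ _ _ _
  (pushforward P (joint X))
  (pushforward P (joint Y))) => //.
- move=> _ _ [E mE ->] [F mF ->]; exists (fun i => E i `&` F i).
    by move=> i; exact: measurableI.
  by rewrite -bigcapI.
- by rewrite bigcup_const.
- move=> _ [E mE ->]; transitivity (\prod_(i < N) P (X i @^-1` E i))%E.
    exact: (indX N E mE).
  transitivity (\prod_(i < N) P (Y i @^-1` E i))%E.
    by apply: eq_bigr => i _; exact: XY.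
  exact/esym/(indY N E mE).
- move=> _; apply: (@le_lt_trans _ _ (P setT)); first exact: lexx.
  by rewrite probability_setT ltry.
Qed.

Lemma measurable_proj (i : 'I_N) :
  measurable_fun [set: g_sigma_algebraType cylinder]
    (fun z : g_sigma_algebraType cylinder => z i).
Proof.
move=> _ E mE; rewrite setTI; apply: sub_sigma_algebra.
(* the cylinder whose only constraint is on the entry [i] *)
exists (fun j => if j == i :> nat then E else setT) => [j|].
  by case: ifP.
apply/seteqP; split=> z /= => [Ezi j _ /=|/(_ i (ltn_ord i))/=].
  by case: eqP => // ->.
by rewrite eqxx.
Qed.

End joint.

Lemma noise_reflection {d} {T : measurableType d} (P : probability T R) n
    (eps : R) (Z : nat -> T -> 'cV[R]_n) (i : nat) (E : set 'cV[R]_n) :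
  eps != 0 -> is_gaussian_noise P eps Z -> measurable E ->
  P (Z i @^-1` (-%R @^-1` E)) = P (Z i @^-1` E).
Proof.
move=> eps0 [_ _ gZ] mE.
have mS : measurable ((fun x => eps *: x) @^-1` E : set 'cV[R]_n).
  rewrite -[X in measurable X]setTI.
  have : measurable_fun setT (fun x : 'cV[R]_n => eps *: x); last exact.
  apply/measurable_fun_cVP => j.
  under eq_fun do rewrite mxE.
  by apply: measurable_funM => //; exact: measurable_coord.
have := std_gaussianN P _ _ _ (gZ i) mS.
congr (P _ = P _); apply/seteqP; split=> w /=;
  by rewrite ?scalerN scalerA divff// scale1r.
Qed.

(** The half-space and its image under reflection cover the space and have the
    same probability, so that each has probability at least [1/2]. *)
Lemma noise_halfspace {d} {T : measurableType d} (P : probability T R) n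
    (eps : R) (Z : nat -> T -> 'cV[R]_n) (N : nat) (x : nat -> 'cV[R]_n) :
  eps != 0 -> is_gaussian_noise P eps Z ->
  measurable [set w | 0 <= \sum_(i < N) dot (Z i w) (x i)] /\
  ((1 / 2)%:E <= P [set w | 0%R <= \sum_(i < N) dot (Z i w) (x i)]%R)%E.
Proof.
move=> eps0 gZ; have [mZ indZ _] := gZ.
pose S (z : nat -> 'cV[R]_n) := \sum_(i < N) dot (z i) (x i).
have mS : measurable_fun [set: g_sigma_algebraType (@cylinder _ 'cV[R]_n N)]
    (S : g_sigma_algebraType (@cylinder _ 'cV[R]_n N) -> R).
  apply: measurable_sum => i; apply: measurable_dot => //.
  exact: measurable_proj.
pose NZ i w := - Z i w.
have mNZ i : measurable_fun setT (NZ i).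
  by apply: measurableT_comp (mZ i); exact: measurable_oppcV.
have indNZ : mutually_independent P NZ.
  move=> m E mE; apply: (indZ m (fun i => -%R @^-1` E i)) => i.
  by rewrite -[X in measurable X]setTI; exact: measurable_oppcV.
pose A := [set z : g_sigma_algebraType (@cylinder _ 'cV[R]_n N) | 0 <= S z].
have mA : measurable A.
  have := mS measurableT _ (measurable_itv `[0, +oo[).
  rewrite setTI; congr measurable; apply/seteqP; split=> z /=;
  by rewrite in_itv/= andbT.
have eqP : P (joint N Z @^-1` A) = P (joint N NZ @^-1` A).
  apply: joint_law_eq => // i E mE.
  by rewrite -(noise_reflection P n eps Z i E eps0 gZ mE).
have mZA : measurable (joint N Z @^-1` A).
  by rewrite -[X in measurable X]setTI; apply: (measurable_joint N Z mZ).
have mNZA : measurable (joint N NZ @^-1` A).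
  by rewrite -[X in measurable X]setTI; apply: (measurable_joint N NZ mNZ).
split; first exact: mZA.
change ((1 / 2)%:E <= P (joint N Z @^-1` A))%E.
have cover : [set: T] `<=` joint N Z @^-1` A `|` joint N NZ @^-1` A.
  move=> w _; rewrite /A/= /S/=.
  have -> : \sum_(i < N) dot (joint N NZ w i) (x i)
          = - \sum_(i < N) dot (joint N Z w i) (x i).
    by rewrite -sumrN; apply: eq_bigr => i _; rewrite -dotNl.
  by rewrite oppr_ge0; apply/orP; exact: le_total.
have : (1 <= P (joint N Z @^-1` A) + P (joint N Z @^-1` A))%E.
  rewrite {2}eqP -(probability_setT P).
  apply: le_trans (measureU2 P mZA mNZA).
  by apply: le_measure => //; rewrite inE//; exact: measurableU.
have fP : P (joint N Z @^-1` A) \is a fin_num by exact: fin_num_measure.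
rewrite -(fineK fP) -EFinD !lee_fin => PA1.
lra.
Qed.

End ReflectionSymmetry.

(** * Invariance of the trapping ball *)

Section Trapping.
Context {R : realType}.

(** The last time at which [g] is at most [c] is the supremum of a closed set,
    hence attained. *)
Lemma last_sublevel_time (g : R -> R) (a b c : R) : a <= b ->
  {within `[a, b], continuous g} -> g a <= c -> c < g b ->
  exists s, [/\ a <= s, s < b, g s <= c & forall t, s < t -> t <= b -> c < g t].
Proof.
move=> ab cg gac cgb.
pose S := [set t | t \in `[a, b] /\ g t <= c].
have Sa : S a by rewrite /S/= in_itv/= lexx.
have S0 : S !=set0 by exists a.
have ubS : has_ubound S by exists b => t [/itvP ->].
have clS : closed S.
  rewrite (_ : S = `[a, b]%classic `&` g @^-1` [set x | x <= c]); last first.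
    by apply/seteqP; split=> t.
  rewrite closed_setSI; last exact: interval_closed.
  by move/continuous_closedP : cg; apply; exact: closed_le.
have Ss : S (sup S) by apply: clS; exact: closure_sup.
have [/[!in_itv]/= /andP[as_ sb] gs] := Ss.
exists (sup S); split => //.
- rewrite lt_neqAle sb andbT; apply: contraTneq cgb => <-; rewrite -leNgt//.
- move=> t st tb; rewrite ltNge; apply/negP => gtc.
  have : S t by split=> //; rewrite in_itv/= tb (le_trans as_ (ltW st)).
  by move=> /(ub_le_sup ubS); rewrite leNgt st.
Qed.

Lemma is_derive_sq_enorm n (x : R -> 'cV[R]_n) (t : R) (dx : 'cV[R]_n) :
  is_derive t 1 x dx ->
  is_derive t 1 (fun s => dot (x s) (x s)) (2 * dot dx (x t)).
Proof.
move=> dxP.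
have [/derivable_mxP dcoord dval] := dxP.
have H (i : 'I_n) : is_derive t 1 (fun s => x s i 0) (dx i 0).
  apply: DeriveDef; first exact: dcoord.
  by rewrite -dval derive_mx// mxE.
rewrite /dot mulr_sumr.
rewrite (_ : (fun s => _) = \sum_(i < n) ((fun s => x s i 0) * (fun s => x s i 0))); last first.
  by apply/funext => s; rewrite fct_sumE.
apply: is_derive_eq.
apply: eq_bigr => i _; rewrite /GRing.scale/=; ring.
Qed.

Lemma continuous_sq_enorm n : continuous (fun y : 'cV[R]_n => dot y y).
Proof.
apply: continuous_big => [|i _ y]; first exact: add_continuous.
have ci := @coord_continuous R n 1 i 0 y; exact: (cvgM ci ci).
Qed.

(** A trajectory outside the ball at time [b] has a last time [s] inside it.
    Just after [s] it runs through the annulus, where its square norm cannot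
    grow, so the mean value theorem forbids it to have left the ball. *)
Lemma trapped n (F : 'cV[R]_n -> 'cV[R]_n) (rho delta : R) (x : R -> 'cV[R]_n)
    (v : 'cV[R]_n) :
  0 < rho -> 0 < delta ->
  (forall y, rho <= enorm y <= rho + delta -> dot (F y) y <= 0) ->
  eball rho v -> is_solution F x v ->
  forall t, 0 <= t -> eball rho (x t).
Proof.
move=> rho0 delta0 trap vrho [x0 cx dx] b b0; rewrite /eball/= leNgt.
apply/negP => xb.
pose g t := dot (x t) (x t).
have cg : {within `[0, +oo[, continuous g}.
  by apply: (@within_continuous_comp _ _ _ _ x (fun y => dot y y)) => // y _;
    exact: continuous_sq_enorm.
have sq (c : R) t : 0 <= c -> (g t <= c ^+ 2) = (enorm (x t) <= c).
  by move=> c0; rewrite /g -enorm_sq ler_sqr// nnegrE enorm_ge0.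
have cgs a c : 0 <= a -> {within `[a, c], continuous g}.
  move=> a0; apply: continuous_subspaceW cg => t /=.
  by rewrite !in_itv/= andbT => /andP[/(le_trans a0)].
have [|||s [s0 sb gs gt]] := @last_sublevel_time g 0 b (rho ^+ 2) b0.
- exact: cgs.
- by rewrite sq ?(ltW rho0)// x0.
- by rewrite ltNge sq ?(ltW rho0)// -ltNge.
have gs' : g s < (rho + delta) ^+ 2.
  by apply: le_lt_trans gs _; rewrite ltr_sqr ?nnegrE ?ltW ?addr_gt0// ltrDl.
have /subspace_continuousP/(_ s) := cg.
rewrite /= in_itv/= s0 => /(_ isT) /cvgr_lt/(_ _ gs').
rewrite near_withinE => /nbhs_ballP[e e0 se].
(* up to [b'] continuity at [s] keeps the trajectory within the annulus *)
pose b' := Order.min b (s + e / 2).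
have sb' : s < b' by rewrite lt_min sb ltrDl divr_gt0.
have b'b : b' <= b by rewrite ge_min lexx.
have b'e : b' <= s + e / 2 by rewrite ge_min lexx orbT.
have [c|c|c cin gbs] := @MVT R g (fun t => 2 * dot (F (x t)) (x t)) s b' sb'.
- by move=> /[!in_itv]/= /andP[sc _]; apply: is_derive_sq_enorm;
    exact: dx (le_lt_trans s0 sc).
- exact: cgs.
have : 0 < g b' - g s by rewrite subr_gt0 (le_lt_trans gs)// gt.
apply/negP; rewrite -leNgt gbs.
move: cin; rewrite in_itv/= => /andP[sc cb'].
rewrite mulr_le0_ge0 ?subr_ge0 ?(ltW sb')// pmulr_rle0//; apply: trap.
have rc : rho < enorm (x c).
  by rewrite ltNge -sq ?(ltW rho0)// -ltNge gt// (le_trans (ltW cb')).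
rewrite (ltW rc)/= -sq ?(ltW (addr_gt0 _ _))//.
rewrite ltW//; apply: se => /=; last by rewrite in_itv/= andbT (le_trans s0)// ltW.
rewrite /ball/= distrC ger0_norm ?subr_ge0 ?(ltW sc)//.
lra.
Qed.

End Trapping.

(** * Integrals of functions that need not be measurable *)

Section NonmeasurableIntegrand.
Context {d} {T : measurableType d} {R : realType}.
Implicit Types f g : T -> \bar R.

(** The integral of a nonnegative function is a supremum over the simple
    functions below it, which is monotone whether or not the functions are
    measurable. *)
Lemma ge0_le_integral_unmeasurable (mu : {measure set T -> \bar R}) f g :
  (forall x, 0 <= f x)%E -> (forall x, f x <= g x)%E ->
  (\int[mu]_x f x <= \int[mu]_x g x)%E.
Proof.
move=> f0 fg; rewrite !ge0_integralTE//; last first.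
  by move=> x; apply: le_trans (fg x).
apply: le_ereal_sup => _ [s /= sf <-]; exists s => //= x.
exact: le_trans (sf x) (fg x).
Qed.

(** [fine] sends an infinite value to [0], so both bounds matter: the lower one
    excludes a null integral and the upper one an infinite integral. *)
Lemma fine_integral_gt0 (mu : {measure set T -> \bar R}) (p f : T -> R)
    (a b : R) :
  measurable_fun [set: T] p -> (forall x, 0 <= p x) ->
  (\int[mu]_x (p x)%:E = 1)%E -> 0 < a ->
  (forall x, a * p x <= f x <= b * p x) ->
  0 < fine (\int[mu]_x (f x)%:E).
Proof.
move=> mp p0 p1 a0 fP.
have f0 x : 0 <= f x by case/andP: (fP x) => + _; apply: le_trans; rewrite mulr_ge0// ltW.
have intZ c : 0 <= c -> (\int[mu]_x (c * p x)%:E = c%:E)%E.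
  move=> c0; under eq_integral do rewrite EFinM.
  rewrite ge0_integralZl_EFin//.
  - by rewrite p1 mule1.
  - by move=> x _; rewrite lee_fin.
  - exact/measurable_EFinP.
apply: fine_gt0; apply/andP; split.
  apply: (@lt_le_trans _ _ a%:E); first by rewrite lte_fin.
  rewrite -(intZ a (ltW a0)); apply: ge0_le_integral_unmeasurable => x.
    by rewrite lee_fin mulr_ge0// ltW.
  by rewrite lee_fin; case/andP: (fP x).
apply: (@le_lt_trans _ _ (Order.max 0 b)%:E); last exact: ltry.
rewrite -intZ ?le_max ?lexx//; apply: ge0_le_integral_unmeasurable => x.
  by rewrite lee_fin.
rewrite lee_fin; case/andP: (fP x) => _ /le_trans; apply.
by rewrite ler_wpM2r// le_max lexx orbT.
Qed.

End NonmeasurableIntegrand.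

(** * The likelihood ratio and the normalising constant *)

Section Likelihood.
Context {R : realType}.

Lemma gauss_pdfB n (s : R) (z x : 'cV[R]_n) :
  gauss_pdf s (z - x) =
  gauss_pdf s z * expR ((2 * dot z x - dot x x) / (2 * s ^+ 2)).
Proof.
rewrite /gauss_pdf -[RHS]mulrA -expRD !enorm_sq dot_subsq; congr (_ * expR _).
ring.
Qed.

Lemma gauss_pdf_le n (s : R) (z : 'cV[R]_n) :
  gauss_pdf s z <= normal_peak s ^+ n.
Proof.
rewrite ler_piMr ?exprn_ge0 ?normal_peak_ge0// expR_le1 oppr_le0.
by rewrite divr_ge0 ?sqr_ge0// mulr_ge0 ?sqr_ge0.
Qed.

(** From [dot (y - z) (y - z) <= 2 * dot y y + 2 * dot z z]. *)
Lemma gauss_pdf_subl_ge n (s : R) (y z : 'cV[R]_n) (M : R) :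
  enorm z <= M ->
  normal_peak s ^+ n * expR (- ((dot y y + M ^+ 2) / s ^+ 2))
    <= gauss_pdf s (y - z).
Proof.
move=> zM; rewrite /gauss_pdf ler_wpM2l ?exprn_ge0 ?normal_peak_ge0//.
rewrite ler_expR lerN2 invfM mulrA ler_wpM2r ?invr_ge0 ?sqr_ge0//.
have zz : dot z z <= M ^+ 2.
  by rewrite -enorm_sq ler_sqr ?nnegrE ?enorm_ge0// (le_trans (enorm_ge0 _ z)).
have := dot_ge0 _ (y + z).
rewrite -{1 2}[z]opprK dot_subsq (dotC _ y) !dotNl (dotC _ z (- z)) dotNl.
rewrite enorm_sq dot_subsq (dotC _ z y); lra.
Qed.

(** Each factor of the likelihood lies between two positive constants, uniformly
    over the ball, so the weight is comparable to the prior, whose integral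
    is [1]. *)
Lemma smoothing_normaliser_gt0 d m (rho h eps : R) (H : 'M[R]_(m, d))
    (Psi : R -> 'cV[R]_d -> 'cV[R]_d) (q : 'cV[R]_d -> R) (k : nat)
    (Y : nat -> 'cV[R]_m) :
  eps != 0 -> is_density q -> (forall v, ~ eball rho v -> q v = 0) ->
  (forall i v, eball rho v -> eball rho (Psi (i%:R * h) v)) ->
  0 < fine (\int[lebesgue_cV d]_v (smoothing_weight rho h eps H Psi q k Y v)%:E).
Proof.
move=> eps0 [mq q0 q1] q_supp Psi_ball.
pose c i := normal_peak eps ^+ m *
  expR (- ((dot (Y i) (Y i) + (opnorm H * rho) ^+ 2) / eps ^+ 2)).
apply: (fine_integral_gt0 (lebesgue_cV d) q _ (\prod_(i < k.+1) c i)
  (\prod_(i < k.+1) normal_peak eps ^+ m) mq q0 q1).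
  apply: prodr_gt0 => i _.
  by rewrite mulr_gt0 ?expR_gt0// exprn_gt0// normal_peak_gt0.
move=> v; rewrite /smoothing_weight.
case: ifPn => [vrho|/negP/q_supp ->]; last by rewrite !mulr0 lexx.
rewrite ![_ * q v]mulrC; apply/andP; split; apply: ler_wpM2l => //.
  apply: ler_prod => i _; apply/andP; split.
    by rewrite mulr_ge0 ?expR_ge0// exprn_ge0// normal_peak_ge0.
  apply: gauss_pdf_subl_ge; apply: le_trans (enorm_mulmx _ _ _ _) _.
  by rewrite ler_wpM2l ?opnorm_ge0//; exact: Psi_ball.
apply: ler_prod => i _; rewrite gauss_pdf_le andbT ltW// gauss_pdf_gt0//.
Qed.

(** Half of the factor [1 / e] is spent on the prior ratio, half on the likelihood
    ratio.  In the exponent of the latter the noise term is nonnegative and the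
    quadratic term is at most [1/2]. *)
Lemma smoothing_weight_ratio d m (rho h eps : R) (H : 'M[R]_(m, d))
    (Psi : R -> 'cV[R]_d -> 'cV[R]_d) (q : 'cV[R]_d -> R) (k : nat)
    (z : nat -> 'cV[R]_m) (u v : 'cV[R]_d) :
  let Y i := H *m Psi (i%:R * h) u + z i in
  let x i := H *m (Psi (i%:R * h) v - Psi (i%:R * h) u) in
  eps != 0 -> eball rho u -> eball rho v -> 0 < q u ->
  expR (- (1 / 2)) * q u <= q v ->
  0 <= \sum_(i < k.+1) dot (z i) (x i) ->
  \sum_(i < k.+1) dot (x i) (x i) <= eps ^+ 2 ->
  0 < smoothing_weight rho h eps H Psi q k Y u /\
  1 / expR 1 <= smoothing_weight rho h eps H Psi q k Y v /
                smoothing_weight rho h eps H Psi q k Y u.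
Proof.
move=> Y x eps0 urho vrho qu qv S0 xeps.
have e2 : 0 < eps ^+ 2 by rewrite exprn_even_gt0.
rewrite /smoothing_weight (_ : enorm u <= rho)// (_ : enorm v <= rho)//.
have Yu i : Y i - H *m Psi (i%:R * h) u = z i by rewrite /Y addrAC subrr add0r.
have Yv i : Y i - H *m Psi (i%:R * h) v = z i - x i.
  by rewrite /Y /x mulmxBr opprB addrA [z i + _]addrC.
have gz : 0 < \prod_(i < k.+1) gauss_pdf eps (z i).
  by apply: prodr_gt0 => i _; exact: gauss_pdf_gt0.
under [X in _ * X / _]eq_bigr do rewrite Yv gauss_pdfB.
under [X in _ / (_ * X)]eq_bigr do rewrite Yu.
under [X in 0 < _ * X]eq_bigr do rewrite Yu.
split; first exact: mulr_gt0.
rewrite big_split/= -expR_sum ler_pdivlMr ?mulr_gt0//.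
set G := \prod_(i < k.+1) _; set E := expR (\sum_(i < k.+1) _).
rewrite mulrA (_ : q v * (G * E) = E * q v * G); last by ring.
rewrite ler_pM2r//.
rewrite div1r -expRN.
have -> : expR (- 1) = expR (- (1 / 2)) * expR (- (1 / 2)) :> R.
  by rewrite -expRD; congr expR; lra.
rewrite -mulrA ler_pM ?mulr_ge0 ?expR_ge0 ?(ltW qu)//.
rewrite ler_expR -mulr_suml ler_pdivlMr ?(mulr_gt0 _ e2)//.
rewrite sumrB -mulr_sumr; lra.
Qed.

Lemma ediam_ge n (S : set 'cV[R]_n) (x y : 'cV[R]_n) :
  S x -> S y -> ((enorm (x - y))%:E <= ediam S)%E.
Proof.
move=> Sx Sy; rewrite le_max; apply/orP; right.
by apply: ereal_sup_ubound; exists x => //; exists y.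
Qed.

Lemma continuous_gt_enorm n (q : 'cV[R]_n -> R) (u : 'cV[R]_n) (c : R) :
  {for u, continuous q} -> c < q u ->
  exists2 r, 0 < r & forall v, enorm (v - u) < r -> c < q v.
Proof.
move=> /cvgr_gt/[apply] /nbhs_ballP[r r0 rq]; exists r => // v vr.
apply: rq; split => // i j; rewrite ord1 /ball/= distrC.
by have := coord_le_enorm _ (v - u) i; rewrite !mxE => /le_lt_trans; apply.
Qed.

End Likelihood.

(** * The lower bound on the expected diameter *)

(* The noise is universally quantified after the threshold eps0, which thus
   depends neither on k nor on the probability space. The integral over P of
   the nonnegative diameter is the library's supremum of integrals of simple
   functions below it, so no measurability has to be assumed. *)
Theorem theorem3p4 (R : realType) (d m : nat)
    (A : {linear 'cV[R]_d -> 'cV[R]_d})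
    (B : {bilinear 'cV[R]_d -> 'cV[R]_d -> 'cV[R]_d})
    (f : 'cV[R]_d)
    (rho delta : R) (rho_gt0 : 0 < rho) (delta_gt0 : 0 < delta)
    (trapping : forall v : 'cV[R]_d, rho <= enorm v <= rho + delta ->
       dot (- A v - B v v + f) v <= 0)
    (Psi : R -> 'cV[R]_d -> 'cV[R]_d)
    (PsiP : forall v : 'cV[R]_d, eball rho v ->
       is_solution (fun x => - A x - B x x + f) (fun t => Psi t v) v)
    (h : R) (h_gt0 : 0 < h)
    (H : 'M[R]_(m, d)) (H_neq0 : H != 0)
    (q : 'cV[R]_d -> R) (q_density : is_density q)
    (q_supp : forall v : 'cV[R]_d, ~ eball rho v -> q v = 0)
    (u : 'cV[R]_d) (u_ball : eball rho u)
    (U : set 'cV[R]_d) (U_ball : U `<=` eball rho)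
    (dmax : R) (dmax_gt0 : 0 < dmax)
    (U_dist : [set enorm (v - u) | v in U] = `[0, dmax]%classic)
    (CU : R)
    (U_leaf : forall v : 'cV[R]_d, U v ->
       (ereal_sup [set (\sum_(i < k.+1)
            enorm (Psi (i%:R * h) v - Psi (i%:R * h) u) ^+ 2)%:E
          | k in [set: nat]]
        <= (CU * enorm (v - u) ^+ 2)%:E)%E)
    (q_cont : {for u, continuous q})
    (q_gt0 : forall v : 'cV[R]_d, U v -> 0 < q v) :
  exists2 eps0 : R, 0 < eps0 &
    forall eps : R, 0 < eps -> eps < eps0 ->
    forall (k : nat) (disp : measure_display) (T : measurableType disp)
      (P : probability T R) (Z : nat -> T -> 'cV[R]_m),
      is_gaussian_noise P eps Z ->
      let Y (w : T) (i : nat) : 'cV[R]_m := H *m Psi (i%:R * h) u + Z i w in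
      let mu (w : T) : 'cV[R]_d -> R :=
        smoothing_density rho h eps H Psi q k (Y w) in
      let D (w : T) : set 'cV[R]_d := [set v | mu w v / mu w u >= 1 / expR 1] in
      ((1 / (2 * opnorm H * Num.sqrt CU) * eps)%:E <= \int[P]_w ediam (D w))%E.
Proof.
have psi0 v : eball rho v -> Psi 0 v = v by move=> /PsiP[].
have Psi_ball i v : eball rho v -> eball rho (Psi (i%:R * h) v).
  move=> vrho; apply: (trapped _ _ _ _ _ _ rho_gt0 delta_gt0 trapping vrho (PsiP v vrho)).
  by rewrite mulr_ge0// ltW.
have U_at r : 0 <= r -> r <= dmax -> exists2 v, U v & enorm (v - u) = r.
  move=> r0 rd; have : `[0, dmax]%classic r by rewrite /= in_itv/= r0.
  by rewrite -U_dist => -[w Uw wr]; exists w.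
have U_sum k v : U v ->
    \sum_(i < k.+1) enorm (Psi (i%:R * h) v - Psi (i%:R * h) u) ^+ 2
      <= CU * enorm (v - u) ^+ 2.
  move=> /U_leaf; rewrite -lee_fin; apply: le_trans.
  by apply: ereal_sup_ubound; exists k.
have qu : 0 < q u.
  have [w Uw /enorm_eq0/subr0_eq wu] := U_at 0 (lexx 0) (ltW dmax_gt0).
  by rewrite -wu; exact: q_gt0.
(* the term of index [0] in the leaf sum is [|v - u| ^ 2] itself *)
have CU0 : 0 < CU.
  have [w Uw wu] := U_at dmax (ltW dmax_gt0) (lexx _).
  have := U_sum 0%N w Uw.
  rewrite big_ord1 mul0r !psi0//; last exact: U_ball.
  rewrite wu -ler_pdivrMr ?exprn_gt0// divff ?gt_eqF ?exprn_gt0//.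
  exact: lt_le_trans.
pose L := opnorm H * Num.sqrt CU.
have L0 : 0 < L by rewrite mulr_gt0 ?opnorm_gt0// sqrtr_gt0.
have [|r0 r0_gt0 qr0] := continuous_gt_enorm _ _ _ (expR (- (1 / 2)) * q u) q_cont.
  by rewrite gtr_pMl// expR_lt1; lra.
exists (Order.min dmax r0 * L) => [|eps eps0].
  by rewrite mulr_gt0// lt_min dmax_gt0.
rewrite -ltr_pdivrMr// lt_min => /andP[/ltW epsd epsr] k disp T P Z gZ.
pose Y (w : T) (i : nat) := H *m Psi (i%:R * h) u + Z i w.
pose mu (w : T) := smoothing_density rho h eps H Psi q k (Y w).
pose D (w : T) := [set v | 1 / expR 1 <= mu w v / mu w u].
change ((1 / (2 * opnorm H * Num.sqrt CU) * eps)%:E <= \int[P]_w ediam (D w))%E.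
set r := eps / L in epsd epsr.
have rp : 0 < r by exact: divr_gt0.
have [v Uv vr] := U_at r (ltW rp) epsd.
pose x i := H *m (Psi (i%:R * h) v - Psi (i%:R * h) u).
have epsN0 : eps != 0 by rewrite gt_eqF.
have sumx : \sum_(i < k.+1) dot (x i) (x i) <= eps ^+ 2.
  have -> : eps ^+ 2 = opnorm H ^+ 2 * (CU * enorm (v - u) ^+ 2).
    rewrite vr -[in X in X * r ^+ 2](sqr_sqrtr (ltW CU0)) -!exprMn mulrA.
    by rewrite /r mulrC divfK ?gt_eqF.
  apply: le_trans (ler_wpM2l (sqr_ge0 _) (U_sum k v Uv)).
  rewrite mulr_sumr; apply: ler_sum => i _.
  rewrite -enorm_sq -exprMn ler_sqr ?nnegrE ?enorm_ge0//; first exact: enorm_mulmx.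
  by rewrite mulr_ge0 ?opnorm_ge0 ?enorm_ge0.
have [mA PA] := noise_halfspace P m eps Z k.+1 x epsN0 gZ.
set A0 := [set w | _] in mA PA.
have DA w : A0 w -> (r%:E <= ediam (D w))%E.
  move=> A0w.
  have [wu wvu] : 0 < smoothing_weight rho h eps H Psi q k (Y w) u /\
      1 / expR 1 <= smoothing_weight rho h eps H Psi q k (Y w) v /
                    smoothing_weight rho h eps H Psi q k (Y w) u.
    apply: (smoothing_weight_ratio d m rho h eps H Psi q k (Z ^~ w) u v) => //.
      exact: U_ball.
    by apply/ltW/qr0; rewrite vr.
  have C0 := smoothing_normaliser_gt0 d m rho h eps H Psi q k (Y w) epsN0 q_density
    q_supp Psi_ball.
  (* the normalising constants cancel *)
  have ratio y : mu w y / mu w u = smoothing_weight rho h eps H Psi q k (Y w) y /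
                   smoothing_weight rho h eps H Psi q k (Y w) u.
    by rewrite /mu /smoothing_density invfM invrK mulrACA mulVf ?gt_eqF// mulr1.
  have Dv : D w v by rewrite /D /mkset ratio.
  have Du : D w u.
    rewrite /D /mkset ratio divff ?gt_eqF// ler_pdivrMr ?expR_gt0//.
    by rewrite mul1r -[leLHS]expR0 ler_expR ler01.
  by have := ediam_ge _ _ _ _ Dv Du; rewrite vr.
(* off the half-space the diameter is only known to be nonnegative *)
apply: (@le_trans _ _ (\int[P]_w (r%:E * (\1_A0 w)%:E))%E); last first.
  apply: ge0_le_integral_unmeasurable => w.
    by rewrite mule_ge0// lee_fin// ltW.
  rewrite indicE; case: (boolP (w \in A0)) => [/set_mem/DA|_].
    by rewrite mule1.
  by rewrite mule0 le_max lexx.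
rewrite ge0_integralZl_EFin ?(ltW rp)//; last first.
  by apply/measurable_EFinP.
rewrite integral_indic// setIT.
apply: le_trans (lee_wpmul2l _ PA); last by rewrite lee_fin ltW.
rewrite -EFinM lee_fin /r /L.
rewrite -mulrA invfM; lra.
Qed.
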